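(* Let $k,n\in\mathbb{N}$ and let $\mathbf{E}$ be an ideal cipher, i.e. drawn uniformly from $\mathsf{Ics}(k,n)$. Let $\mathcal{A}$ be a quantum adversary that makes at most $p$ quantum queries in total to the ideal-cipher oracles $\mathbf{E},\mathbf{E}^{-1}$, and at most $q$ classical, non-adaptive queries in total to the construction oracles $\textsc{Ev},\textsc{Inv}$. Then \[\mathsf{Adv}^{\mathsf{sprp}\text{-}\mathsf{na}}_{\mathsf{FX}}(\mathcal{A})\le\sqrt{8p^2q/2^{k+n}}.\]
   Context: $\mathsf{Ics}(k,n)$ is the set of all functions $\mathbf{E}:\{0,1\}^k\times\{0,1\}^n\to\{0,1\}^n$ such that each $\mathbf{E}_K=\mathbf{E}(K,\cdot)$ is a permutation of $\{0,1\}^n$. Quantum access to $\mathbf{E}$ is the unitary $|K,x,y\rangle\mapsto|K,x,y\oplus\mathbf{E}_K(x)\rangle$, and similarly for $\mathbf{E}^{-1}$. The FX blockcipher with key $K_1\|K_2\in\{0,1\}^k\times\{0,1\}^n$ is $\mathsf{FX}[\mathbf{E}](K_1\|K_2,x)=\mathbf{E}_{K_1}(x\oplus K_2)\oplus K_2$. Its inverse is $\mathsf{FX}[\mathbf{E}]^{-1}(K_1\|K_2,y)=\mathbf{E}^{-1}_{K_1}(y\oplus K_2)\oplus K_2$. The SPRP game with bit $b\in\{0,1\}$ samples $\mathbf{E}$ uniformly from $\mathsf{Ics}(k,n)$, samples a uniform key $K_1\|K_2$, and samples an independent uniform permutation $P$ of $\{0,1\}^n$. The adversary gets quantum access to $\mathbf{E},\mathbf{E}^{-1}$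 and access to $\textsc{Ev},\textsc{Inv}$: - if $b=1$, $\textsc{Ev}$ returns $\mathsf{FX}[\mathbf{E}](K_1\|K_2,\cdot)$ and $\textsc{Inv}$ returns its inverse; - if $b=0$, $\textsc{Ev}$ returns $P$ and $\textsc{Inv}$ returns $P^{-1}$. The adversary outputs a bit. The advantage is $\Pr[\mathcal{A}\text{ outputs }1\mid b=1]-\Pr[\mathcal{A}\text{ outputs }1\mid b=0]$. Classical, non-adaptive queries means the following. There are fixed strings $M_1,\dots,M_{q'},Y_{q'+1},\dots,Y_q\in\{0,1\}^n$, determined before execution, such that $\mathcal{A}$ queries $\textsc{Ev}$ only on the $M_i$ and $\textsc{Inv}$ only on the $Y_i$. These queries are classical, i.e. not made in superposition. The advantage of such adversaries is denoted $\mathsf{Adv}^{\mathsf{sprp}\text{-}\mathsf{na}}_{\mathsf{FX}}$. *)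

(* Defs.v *)
From HB Require Import structures.
From mathcomp Require Import all_boot all_order all_algebra all_fingroup.
From mathcomp Require Import complex.
From mathcomp Require Import reals.
Set Implicit Arguments. Unset Strict Implicit. Unset Printing Implicit Defensive.
Import Order.TTheory GRing.Theory Num.Theory.
Local Open Scope ring_scope.

Notation bits n := {ffun 'I_n -> bool}.
Definition bxor (n : nat) (x y : bits n) : bits n := [ffun i => x i (+) y i].

Notation Ics k n := {ffun bits k -> {perm bits n}}.

Definition Eval (k n : nat) (E : Ics k n) (K : bits k) (x : bits n) : bits n := E K x.
Definition Einv (k n : nat) (E : Ics k n) (K : bits k) (y : bits n) : bits n :=
  ((E K)^-1)%g y.

Definition FX (k n : nat) (E : Ics k n) (K1 : bits k) (K2 : bits n) (x : bits n) :=
  bxor (Eval E K1 (bxor x K2)) K2.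
Definition FXinv (k n : nat) (E : Ics k n) (K1 : bits k) (K2 : bits n) (y : bits n) :=
  bxor (Einv E K1 (bxor y K2)) K2.

(* Query register for the ideal-cipher oracle: (c, K, x, y); the control bit c
   selects E (c = false) or E^{-1} (c = true). *)
Notation qreg k n := (bool * bits k * bits n * bits n)%type.

Definition sqnorm (R : realType) (z : R[i]) : R := (@complex.Re R z) ^+ 2 + (@complex.Im R z) ^+ 2.

Notation answers q n := {ffun 'I_q -> bits n}.

(* A quantum adversary with p quantum queries to (E, E^{-1}) and q classical
   non-adaptive queries to (Ev, Inv).  The query strings qin are fixed in
   advance: queries i < nev go to Ev (these are M_1..M_{q'}), the others to
   Inv (these are Y_{q'+1}..Y_q).  Since these queries are classical and
   non-adaptive, their answers are modelled as being available to all the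
   adversary's unitaries.  The adversary's state space is the finite type
   qreg k n * work; it starts in the basis state init, applies
   U_0, O, U_1, O, ..., O, U_p and measures in the computational basis,
   outputting 1 iff the outcome is in accept. *)
Record adversary (R : realType) (k n p q : nat) := Adversary {
  work : finType;
  nev : nat;
  qin : 'I_q -> bits n;
  init : (qreg k n * work)%type;
  unit : answers q n -> 'I_p.+1 -> (qreg k n * work)%type -> (qreg k n * work)%type -> R[i];
  unit_unitary : forall a j x y,
    \sum_z conjc (unit a j z x) * unit a j z y = (x == y)%:R;
  accept : answers q n -> pred (qreg k n * work)%type
}.
Arguments work {R k n p q} _.
Arguments nev {R k n p q} _.
Arguments qin {R k n p q} _ _.
Arguments init {R k n p q} _.
Arguments unit {R k n p q} _ _ _ _ _.
Arguments accept {R k n p q} _ _ _.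

Section Exec.
Variables (R : realType) (k n p q : nat) (A : adversary R k n p q).
Local Notation X := (qreg k n * work A)%type.
Local Notation state := (X -> R[i]).

Definition apply_unit (a : answers q n) (j : nat) (psi : state) : state :=
  fun x => \sum_y unit A a (inord j) x y * psi y.

(* quantum oracle |c,K,x,y,w> |-> |c,K,x, y xor f_c(K,x), w>,
   with f_false = E, f_true = E^{-1} *)
Definition qoracle (E : Ics k n) (psi : state) : state :=
  fun z => let: ((c, K, x, y), w) := z in
    psi ((c, K, x, bxor y (if c then Einv E K x else Eval E K x)), w).

Fixpoint run_aux (E : Ics k n) (a : answers q n) (j : nat) : state :=
  match j with
  | 0 => apply_unit a 0 (fun x => (x == init A)%:R)
  | j'.+1 => apply_unit a j'.+1 (qoracle E (run_aux E a j'))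
  end.

Definition prob_out1 (E : Ics k n) (a : answers q n) : R :=
  \sum_(x | accept A a x) sqnorm (run_aux E a p x).

Definition real_answers (E : Ics k n) (K1 : bits k) (K2 : bits n) : answers q n :=
  [ffun i : 'I_q => if (i < nev A)%N then FX E K1 K2 (qin A i) else FXinv E K1 K2 (qin A i)].
Definition ideal_answers (P : {perm bits n}) : answers q n :=
  [ffun i : 'I_q => if (i < nev A)%N then P (qin A i) else ((P^-1)%g) (qin A i)].

Definition adv_sprp_na : R :=
  (\sum_(E : Ics k n) \sum_(K : bits k * bits n)
      prob_out1 E (real_answers E K.1 K.2))
    / (#|{: Ics k n}| * #|{: bits k * bits n}|)%:R
  - (\sum_(E : Ics k n) \sum_(P : {perm bits n}) prob_out1 E (ideal_answers P))
    / (#|{: Ics k n}| * #|{: {perm bits n}}|)%:R.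
End Exec.

(* Main.v *)
Require Import Defs.
From HB Require Import structures.
From mathcomp Require Import all_boot all_order all_algebra all_fingroup.
From mathcomp Require Import complex reals.
From mathcomp Require Import ring lra.
Set Implicit Arguments.
Unset Strict Implicit.
Unset Printing Implicit Defensive.
Import Order.TTheory GRing.Theory Num.Theory.
Local Open Scope ring_scope.

(* The two games are coupled: in the ideal game, draw the key [K] as well and
   reprogram [E_K1] by transpositions, one per construction query, so that FX
   under [K] answers the queries as [P] does. The reprogrammed cipher is uniform
   and consistent with the answers, so it plays the real game. It differs from
   [E] only at 2q inputs in each direction, and since [E], [P] and hence the
   adversary's state are independent of [K], each oracle input is affected by at
   most 2q of the 2^(k+n) keys. A hybrid argument over the [p] queries bounds the
   distance of the final states by twice the sum of the norms of the affected
   parts of the query states; this distance bounds the difference of the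
   acceptance probabilities, and averaging over [K] by Cauchy-Schwarz gives
   [2 p sqrt (2 q / 2^(k+n))]. *)

(** * Reprogramming a permutation by transpositions *)

Section Patch.
Variable T : finType.
Implicit Types (P pi sigma : {perm T}) (s : seq T).

Definition patch P s pi : {perm T} :=
  foldl (fun (r : {perm T}) u => (r * tperm (r u) (P u))%g) pi s.

(** Each step sends [u] to [P u] by swapping two values. A corrected point other than [u] keeps its
    value, since by injectivity this is neither of the two. *)
Lemma patch_on P s pi : {in s, patch P s pi =1 P}.
Proof.
suff gen s0 : {in s0, pi =1 P} -> {in s0 ++ s, patch P s pi =1 P}.
  by move=> x xs; apply: (gen [::]).
elim: s s0 pi => [|u s IH] s0 pi Hs0 /=; first by rewrite cats0.
rewrite -cat_rcons; apply: IH => x.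
rewrite mem_rcons inE permM => /predU1P [->|/Hs0 px]; first by rewrite tpermL.
have [xu|xu] := eqVneq x u; first by rewrite xu tpermL.
rewrite tpermD //; first by rewrite (inj_eq perm_inj) eq_sym.
by rewrite px (inj_eq perm_inj) eq_sym.
Qed.

Lemma patch_off P s pi x :
  x \notin s -> pi x \notin [seq P u | u <- s] -> patch P s pi x = pi x.
Proof.
elim: s pi => //= u s IH pi; rewrite !inE !negb_or => /andP[xu xs] /andP[pxu pxs].
have e : (pi * tperm (pi u) (P u))%g x = pi x.
  by rewrite permM tpermD 1?eq_sym // (inj_eq perm_inj).
by rewrite IH ?e.
Qed.

(** Conjugating [tperm (pi u) (P u)] by [sigma], which fixes [P u], gives the transposition that
    [pi * sigma] needs at [u]. *)
Lemma patchM P s pi sigma :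
  {in s, forall u, sigma (P u) = P u} ->
  patch P s (pi * sigma)%g = (patch P s pi * sigma)%g.
Proof.
elim: s pi => //= u s IH pi Hs.
rewrite -IH => [|x xs]; last by apply: Hs; rewrite inE xs orbT.
congr (patch P s _); rewrite permM -{1}[P u]Hs ?mem_head //.
by rewrite -tpermJ /conjg -!mulgA mulKVg.
Qed.

Lemma eq_patch P P' s : {in s, P' =1 P} -> patch P' s =1 patch P s.
Proof.
elim: s => //= u s IH H pi; rewrite /patch /= H ?mem_head //.
apply: IH => x xs.
by apply: H; rewrite inE xs orbT.
Qed.

Variables (q : nat) (fwd : pred 'I_q) (y : 'I_q -> T).

Definition query_answers P : {ffun 'I_q -> T} :=
  [ffun i => if fwd i then P (y i) else (P^-1)%g (y i)].

(** The points whose image under [P] the queries reveal; an inverse query contributes its answer. *)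
Definition query_points P : seq T :=
  [seq (if fwd i then y i else query_answers P i) | i : 'I_q].

Lemma query_answers_on P P' :
  {in query_points P, P' =1 P} -> query_answers P' = query_answers P.
Proof.
move=> H; apply/ffunP => i.
have /H : (if fwd i then y i else query_answers P i) \in query_points P.
  exact: image_f.
rewrite !ffunE; case: (fwd i) => // e.
by apply: (@perm_inj _ P'); rewrite e !permKV.
Qed.

Lemma query_answers_pts P P' :
  query_answers P' = query_answers P ->
  query_points P' = query_points P /\ {in query_points P, P' =1 P}.
Proof.
move=> e; split; first by rewrite /query_points e.
move=> _ /imageP[i _ ->]; move/ffunP/(_ i): e; rewrite !ffunE.
by case: (fwd i) => // e; rewrite -{1}e !permKV.
Qed.

Definition patch_queries P pi := patch P (query_points P) pi.

Lemma query_answers_patch P pi :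
  query_answers (patch_queries P pi) = query_answers P.
Proof. exact/query_answers_on/patch_on. Qed.

Lemma eq_patch_queries P P' :
  query_answers P' = query_answers P -> patch_queries P' =1 patch_queries P.
Proof.
by case/query_answers_pts=> e H pi; rewrite /patch_queries e (eq_patch H).
Qed.

(* Right multiplication by [P^-1 * P'] permutes the fibres of [patch_queries P]
   over the permutations that answer the queries as [P] does. *)
Lemma card_patch_fibre P P' :
  query_answers P' = query_answers P ->
  #|[pred pi | patch_queries P pi == P']| = #|[pred pi | patch_queries P pi == P]|.
Proof.
move=> e; have [_ H] := query_answers_pts e.
rewrite -[RHS](card_image (mulIg (P^-1 * P')%g)); apply: eq_card => pi /=.
have fix_ : {in query_points P, forall u, (P^-1 * P')%g (P u) = P u}.
  by move=> u us; rewrite permM permK; apply: H.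
apply/idP/imageP => [/eqP er|[rho /eqP er ->]].
  exists (pi * (P^-1 * P')^-1)%g; last by rewrite mulgKV.
  rewrite inE /patch_queries patchM => [|u us].
  - by rewrite -/(patch_queries P pi) er invMg invgK mulKVg.
  - by rewrite -{1}(fix_ u us) permK.
apply/eqP; rewrite /patch_queries patchM //.
by rewrite -/(patch_queries P rho) er mulKVg.
Qed.

(** When [P] and [P'] give the same answers, as many [pi] are patched to [P'] under [P] as to [P]
    under [P']. Hence uniform [P] and [pi] yield a uniform patched permutation. *)
Lemma sum_patch_queries (R : nmodType)
    (G : {perm T} -> {ffun 'I_q -> T} -> R) :
  \sum_P \sum_pi G (patch_queries P pi) (query_answers P) =
  \sum_pi G pi (query_answers pi) *+ #|{: {perm T}}|.
Proof.
transitivity (\sum_P \sum_(P' | query_answers P' == query_answers P)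
   G P' (query_answers P') *+ #|[pred pi | patch_queries P pi == P']|).
  apply: eq_bigr => P _.
  rewrite (partition_big (patch_queries P)
    (fun P' => query_answers P' == query_answers P)) /=; last first.
    by move=> pi _; rewrite query_answers_patch.
  apply: eq_bigr => P' /eqP e; rewrite e -sumr_const; apply: eq_big => [pi|pi].
    by rewrite inE.
  by move/eqP->.
rewrite (exchange_big_dep predT) //=; apply: eq_bigr => P' _.
rewrite sumrMnr; congr (_ *+ _).
rewrite -[RHS]sum1_card [RHS](partition_big (patch_queries P')
   (fun P => query_answers P' == query_answers P)) /=; last first.
  by move=> pi _; rewrite query_answers_patch.
apply: eq_bigr => P /eqP e; rewrite sum1dep_card.
rewrite (card_patch_fibre e); apply: eq_card => pi.
by rewrite !inE (eq_patch_queries e).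
Qed.

End Patch.

(** * Cauchy-Schwarz inequalities *)

Section CauchySchwarz.
Variables (R : rcfType) (I : finType).
Implicit Types (P : pred I) (a b : I -> R).

Lemma sqr_sum_mul_le P a b :
  (\sum_(i | P i) a i * b i) ^+ 2 <=
  (\sum_(i | P i) a i ^+ 2) * (\sum_(i | P i) b i ^+ 2).
Proof.
(* Lagrange's identity: this double sum is twice the gap between the two sides. *)
have : 0 <= \sum_(i | P i) \sum_(j | P j) (a i * b j - a j * b i) ^+ 2.
  by apply: sumr_ge0 => i _; apply: sumr_ge0 => j _; apply: sqr_ge0.
have -> : \sum_(i | P i) \sum_(j | P j) (a i * b j - a j * b i) ^+ 2 =
   (\sum_(i | P i) a i ^+ 2) * (\sum_(i | P i) b i ^+ 2) *+ 2
   - (\sum_(i | P i) a i * b i) ^+ 2 *+ 2.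
  have sumE (f g : I -> R) : (\sum_(i | P i) f i) * (\sum_(j | P j) g j) =
      \sum_(i | P i) \sum_(j | P j) f i * g j.
    by rewrite mulr_suml; apply: eq_bigr => i _; rewrite mulr_sumr.
  rewrite expr2 mulr2n {2}[(\sum_(i | P i) a i ^+ 2) * _]mulrC !sumE.
  rewrite -big_split -sumrMnl -sumrB; apply: eq_bigr => i _.
  rewrite -big_split -sumrMnl -sumrB; apply: eq_bigr => j _ /=.
  by ring.
by rewrite -mulrnBl pmulrn_lge0 // subr_ge0.
Qed.

Lemma sum_mul_le_sqrt P a b :
  \sum_(i | P i) a i * b i <=
  Num.sqrt (\sum_(i | P i) a i ^+ 2) * Num.sqrt (\sum_(i | P i) b i ^+ 2).
Proof.
rewrite -sqrtrM; last by apply: sumr_ge0 => i _; apply: sqr_ge0.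
apply: (le_trans (ler_norm _)).
by rewrite -sqrtr_sqr ler_wsqrtr // sqr_sum_mul_le.
Qed.

Lemma sum_le_sqrt_card a :
  \sum_i a i <= Num.sqrt (#|I|%:R * \sum_i a i ^+ 2).
Proof.
have := sum_mul_le_sqrt predT a (fun=> 1).
under eq_bigr do rewrite mulr1.
under [X in _ <= _ * Num.sqrt X]eq_bigr do rewrite expr1n.
by rewrite sumr_const mulrC -sqrtrM ?ler0n.
Qed.

End CauchySchwarz.

(** * Norms of complex states *)

Section L2.
Variables (R : realType) (X : finType).
Implicit Types (P : pred X) (f g : X -> R[i]).

Definition l2norm f : R := Num.sqrt (\sum_x sqnorm (f x)).

(** The real part of [conjc z * w]. *)
Definition redot (z w : R[i]) : R :=
  complex.Re z * complex.Re w + complex.Im z * complex.Im w.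

Lemma sqnorm_ge0 (z : R[i]) : 0 <= sqnorm z.
Proof. by rewrite addr_ge0 ?sqr_ge0. Qed.

Lemma sum_sqnorm_ge0 P f : 0 <= \sum_(x | P x) sqnorm (f x).
Proof. by apply: sumr_ge0 => x _; apply: sqnorm_ge0. Qed.
Hint Resolve sum_sqnorm_ge0 : core.

Lemma sqnormN (z : R[i]) : sqnorm (- z) = sqnorm z.
Proof. by case: z => a b; rewrite /sqnorm /= !sqrrN. Qed.

Lemma sqnorm0 : sqnorm (0 : R[i]) = 0.
Proof. by rewrite /sqnorm /= !expr0n addr0. Qed.

Lemma sqnormE (z : R[i]) : (sqnorm z)%:C%C = conjc z * z.
Proof.
case: z => a b; rewrite /sqnorm; apply/eqP; rewrite eq_complex /=.
by apply/andP; split; apply/eqP; ring.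
Qed.

Lemma sqnormD (z w : R[i]) : sqnorm (z + w) = sqnorm z + sqnorm w + redot z w *+ 2.
Proof. by case: z w => [a b] [c d]; rewrite /sqnorm /redot /=; ring. Qed.

Lemma sqnormB (z w : R[i]) : sqnorm (z - w) = sqnorm z + sqnorm w - redot z w *+ 2.
Proof. by case: z w => [a b] [c d]; rewrite /sqnorm /redot /=; ring. Qed.

Lemma sum_redot_le P f g :
  \sum_(x | P x) redot (f x) (g x) <=
  Num.sqrt (\sum_(x | P x) sqnorm (f x)) * Num.sqrt (\sum_(x | P x) sqnorm (g x)).
Proof.
(* A state is read as a real vector over [X * bool], which lists real and imaginary parts. *)
pose ri (h : X -> R[i]) (xb : X * bool) : R :=
  if xb.2 then complex.Re (h xb.1) else complex.Im (h xb.1).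
have E (F : X * bool -> R) (G : X -> R) :
    (forall x, F (x, true) + F (x, false) = G x) ->
    \sum_(x | P x) G x = \sum_(xb | P xb.1) F xb.
  move=> FG; transitivity (\sum_(x | P x) \sum_b F (x, b)).
    by apply: eq_bigr => x _; rewrite big_bool -FG.
  rewrite pair_big /=; apply: eq_big => [[x b]|[x b] _] //=.
  by rewrite andbT.
have := sum_mul_le_sqrt [pred xb | P xb.1] (ri f) (ri g).
by rewrite -!(E _ _ (fun=> erefl)).
Qed.

Lemma eq_l2norm f g :
  f =1 g -> l2norm f = l2norm g.
Proof. by move=> fg; rewrite /l2norm; under eq_bigr do rewrite fg. Qed.

Lemma l2normD f g : l2norm (fun x => f x + g x) <= l2norm f + l2norm g.
Proof.
rewrite -[leRHS]ger0_norm ?addr_ge0 ?sqrtr_ge0 // -sqrtr_sqr ler_wsqrtr //.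
under [leLHS]eq_bigr do rewrite sqnormD.
rewrite /l2norm 2!big_split sumrMnl /= sqrrD !sqr_sqrtr //.
by have := sum_redot_le predT f g; lra.
Qed.

(** The reverse triangle inequality on the coordinates in [P], squared. *)
Lemma sum_sqnormB_ge P f g :
  (Num.sqrt (\sum_(x | P x) sqnorm (f x)) - Num.sqrt (\sum_(x | P x) sqnorm (g x))) ^+ 2
  <= \sum_(x | P x) sqnorm (f x - g x).
Proof.
under [leRHS]eq_bigr do rewrite sqnormB.
rewrite sumrB sumrMnl [X in _ <= X - _]big_split /= sqrrB !sqr_sqrtr //.
by have := sum_redot_le P f g; lra.
Qed.

(* The left-hand side is [sin delta * sin sigma] and the norm is at least
   [2 sin (delta / 2)], where [delta] and [sigma] are the difference and the sum
   of the angles of the two states with the subspace [P]. *)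
Lemma accept_diff_le P f g :
  \sum_x sqnorm (f x) = 1 -> \sum_x sqnorm (g x) = 1 ->
  \sum_(x | P x) sqnorm (f x) - \sum_(x | P x) sqnorm (g x)
  <= l2norm (fun x => f x - g x).
Proof.
rewrite (bigID P) /= => f1; rewrite (bigID P) /= => g1.
apply: (le_trans (ler_norm _)); rewrite -sqrtr_sqr ler_wsqrtr //.
rewrite [leRHS](bigID P) /=.
apply: le_trans (lerD (sum_sqnormB_ge P f g) (sum_sqnormB_ge (predC P) f g)).
move: (sum_sqnorm_ge0 P f) (sum_sqnorm_ge0 (predC P) f) f1 => /=.
move: (sum_sqnorm_ge0 P g) (sum_sqnorm_ge0 (predC P) g) g1 => /=.
move: (\sum_(x | P x) sqnorm (f x)) (\sum_(x | ~~ P x) sqnorm (f x)) => A C.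
move: (\sum_(x | P x) sqnorm (g x)) (\sum_(x | ~~ P x) sqnorm (g x)) => B D.
move=> B0 D0 BD A0 C0 AC.
have eA := sqr_sqrtr A0; have eB := sqr_sqrtr B0.
have eC := sqr_sqrtr C0; have eD := sqr_sqrtr D0.
move: (sqrtr_ge0 A) (sqrtr_ge0 B) (sqrtr_ge0 C) (sqrtr_ge0 D).
move: (Num.sqrt A) (Num.sqrt B) (Num.sqrt C) (Num.sqrt D) eA eB eC eD => a b c d.
move=> eA eB eC eD a0 b0 c0 d0; subst A B C D.
have -> : a ^+ 2 - b ^+ 2 = (a * d - b * c) * (a * d + b * c).
  transitivity (a ^+ 2 * (b ^+ 2 + d ^+ 2) - b ^+ 2 * (a ^+ 2 + c ^+ 2)).
    by rewrite BD AC !mulr1.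
  by ring.
have m1 : (a * b + c * d) ^+ 2 + (a * d - b * c) ^+ 2 = 1.
  transitivity ((a ^+ 2 + c ^+ 2) * (b ^+ 2 + d ^+ 2)); first by ring.
  by rewrite AC BD mulr1.
have m2 : (a * b - c * d) ^+ 2 + (a * d + b * c) ^+ 2 = 1.
  transitivity ((a ^+ 2 + c ^+ 2) * (b ^+ 2 + d ^+ 2)); first by ring.
  by rewrite AC BD mulr1.
rewrite exprMn.
apply: (@le_trans _ _ ((a * d - b * c) ^+ 2)).
  by rewrite ler_piMr ?sqr_ge0 // -m2 lerDr sqr_ge0.
(* With [t = a * b + c * d], the goal amounts to [1 - t ^+ 2 <= 2 - 2 * t]. *)
have := sqr_ge0 (a * b + c * d - 1).
by nra.
Qed.

End L2.

(** * Runs of the adversary and the hybrid argument *)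

Lemma bxorK n (y : bits n) : involutive (@bxor n ^~ y).
Proof. by move=> x; apply/ffunP => i; rewrite !ffunE addbK. Qed.

Lemma bxorKl n (x : bits n) : involutive (bxor x).
Proof. by move=> y; apply/ffunP => i; rewrite !ffunE addKb. Qed.

Section Run.
Variables (R : realType) (k n p q : nat) (A : adversary R k n p q).
Local Notation X := (qreg k n * work A)%type.
Local Notation run := (@run_aux R k n p q A).
Implicit Types (E : Ics k n) (psi : X -> R[i]) (a : answers q n).

Lemma sum_sqnorm_apply_unit a j psi :
  \sum_x sqnorm (apply_unit a j psi x) = \sum_x sqnorm (psi x).
Proof.
have U y y' : \sum_x conjc (unit A a (inord j) x y * psi y) *
      (unit A a (inord j) x y' * psi y') = (y == y')%:R * (conjc (psi y) * psi y').
  rewrite -(unit_unitary a (inord j) y y') mulr_suml; apply: eq_bigr => x _.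
  by rewrite rmorphM mulrACA.
apply: (@complexI R); rewrite !rmorph_sum /=.
under eq_bigr do rewrite sqnormE /apply_unit rmorph_sum mulr_suml.
under [RHS]eq_bigr do rewrite sqnormE.
rewrite exchange_big; apply: eq_bigr => y _ /=.
under eq_bigr do rewrite mulr_sumr.
rewrite exchange_big (bigD1 y) //= U eqxx mul1r big1 ?addr0 // => y' yy'.
by rewrite U eq_sym (negPf yy') mul0r.
Qed.

Definition oracle_fun E (t : bool * bits k * bits n) : bits n :=
  let: (c, K, x) := t in if c then Einv E K x else Eval E K x.

(** The oracle permutes the basis states and leaves the input triple [z.1.1] of each unchanged. *)
Lemma sum_sqnorm_qoracle (S : pred (bool * bits k * bits n)) E psi :
  \sum_(z | S z.1.1) sqnorm (qoracle E psi z) = \sum_(z | S z.1.1) sqnorm (psi z).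
Proof.
pose h (z : X) : X := ((z.1.1, bxor z.1.2 (oracle_fun E z.1.1)), z.2).
have hK : involutive h by case=> [[t y] w]; rewrite /h /= bxorK.
rewrite [RHS](reindex_inj (inv_inj hK)) /=.
by apply: eq_bigr => -[[[[c K] x] y] w].
Qed.

(** The two images agree outside [S]. On [S] each has the norm of the part of [psi] there, so the
    triangle inequality gives the factor 2. *)
Lemma l2norm_qoracleB (S : pred (bool * bits k * bits n)) E E' psi :
  (forall t, ~~ S t -> oracle_fun E' t = oracle_fun E t) ->
  l2norm (fun z => qoracle E' psi z - qoracle E psi z) <=
  Num.sqrt (\sum_(z | S z.1.1) sqnorm (psi z)) *+ 2.
Proof.
move=> EE'; pose g E z := if S z.1.1 then qoracle E psi z else 0.
have gE E0 : l2norm (g E0) = Num.sqrt (\sum_(z | S z.1.1) sqnorm (psi z)).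
  rewrite -(sum_sqnorm_qoracle S E0) big_mkcond /l2norm.
  by congr Num.sqrt; apply: eq_bigr => z _; rewrite /g; case: ifP; rewrite ?sqnorm0.
rewrite (@eq_l2norm _ _ _ (fun z => g E' z + - g E z)) => [|z]; last first.
  rewrite /g; case: ifP => // /negbT /EE'; case: z => [[[[c K] x] y] w] /= e.
  by rewrite e !subrr.
apply: le_trans (l2normD _ _) _.
rewrite mulr2n gE lerD2l -(gE E) /l2norm.
by under eq_bigr do rewrite sqnormN.
Qed.

Lemma sum_sqnorm_run E a j : \sum_x sqnorm (run E a j x) = 1.
Proof.
elim: j => [|j IH] /=; rewrite sum_sqnorm_apply_unit; last first.
  by rewrite (sum_sqnorm_qoracle predT) IH.
rewrite (bigD1 (init A)) //= eqxx big1 ?addr0 => [|x /negPf ->].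
  by rewrite /sqnorm /= expr1n expr0n addr0.
exact: sqnorm0.
Qed.

Lemma l2norm_runB (S : pred (bool * bits k * bits n)) E E' a j :
  (forall t, ~~ S t -> oracle_fun E' t = oracle_fun E t) ->
  l2norm (fun z => run E' a j z - run E a j z) <=
  \sum_(i < j) Num.sqrt (\sum_(z | S z.1.1) sqnorm (run E a i z)) *+ 2.
Proof.
move=> EE'; elim: j => [|j IH].
  rewrite big_ord0 /l2norm big1 ?sqrtr0 // => x _.
  by rewrite subrr sqnorm0.
rewrite big_ord_recr /=.
(* [d1] applies one oracle, an isometry, to both states; [d2] applies both oracles to the state of
   the run with [E]. Thus only runs with [E], which will not depend on the key, enter the bound. *)
pose d1 z : R[i] := qoracle E' (run E' a j) z - qoracle E' (run E a j) z.
pose d2 z : R[i] := qoracle E' (run E a j) z - qoracle E (run E a j) z.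
rewrite (@eq_l2norm _ _ _ (apply_unit a j.+1 (fun z => d1 z + d2 z))) => [|x].
  rewrite /l2norm sum_sqnorm_apply_unit.
  apply: le_trans (l2normD _ _) _; apply: lerD; last exact: l2norm_qoracleB.
  suff -> : l2norm d1 = l2norm (fun z => run E' a j z - run E a j z) by [].
  rewrite /l2norm -(sum_sqnorm_qoracle predT E' (fun z => run E' a j z - _)) /=.
  by congr Num.sqrt; apply: eq_bigr => -[[[[c K] x] y] w].
rewrite /apply_unit -sumrB; apply: eq_bigr => y _.
by rewrite -mulrBr /d1 /d2 addrA subrK.
Qed.

Lemma prob_out1B_le (S : pred (bool * bits k * bits n)) E E' a :
  (forall t, ~~ S t -> oracle_fun E' t = oracle_fun E t) ->
  prob_out1 A E' a - prob_out1 A E a <=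
  \sum_(i < p) Num.sqrt (\sum_(z | S z.1.1) sqnorm (run E a i z)) *+ 2.
Proof.
move=> EE'; apply: le_trans (l2norm_runB a p EE').
by apply: accept_diff_le; apply: sum_sqnorm_run.
Qed.

(** As [psi] does not depend on [i], the sums can be exchanged after Cauchy-Schwarz, and each basis
    state is counted at most [m] times. *)
Lemma sum_hit_le (I : finType) (S : I -> pred (bool * bits k * bits n)) m psi :
  (forall t, (#|[pred i | S i t]| <= m)%N) -> \sum_z sqnorm (psi z) = 1 ->
  \sum_i Num.sqrt (\sum_(z | S i z.1.1) sqnorm (psi z)) <= Num.sqrt (#|I| * m)%:R.
Proof.
move=> Sm psi1; apply: le_trans (sum_le_sqrt_card _) _.
apply: ler_wsqrtr; rewrite natrM ler_wpM2l ?ler0n //.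
under eq_bigr do rewrite sqr_sqrtr ?sum_sqnorm_ge0 //.
apply: (@le_trans _ _ ((\sum_z sqnorm (psi z)) * m%:R)); last first.
  by rewrite psi1 mul1r.
rewrite (exchange_big_dep predT) //= mulr_suml.
apply: ler_sum => z _; rewrite sumr_const -[leLHS]mulr_natr.
rewrite ler_wpM2l ?sqnorm_ge0 //.
by rewrite ler_nat; apply: Sm.
Qed.

End Run.

(** * Reprogramming the cipher under FX *)

Section Reprogram.
Variables (k n q : nat) (fwd : pred 'I_q) (y : 'I_q -> bits n).
Implicit Types (E : Ics k n) (P pi : {perm bits n}).
Local Notation ans := (query_answers fwd y).

Definition xor_perm (K2 : bits n) : {perm bits n} := perm (inv_inj (bxorK K2)).

Definition whiten (K2 : bits n) pi : {perm bits n} :=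
  (xor_perm K2 * pi * xor_perm K2)%g.

Lemma whitenE K2 pi x : whiten K2 pi x = bxor (pi (bxor x K2)) K2.
Proof. by rewrite !permM !permE. Qed.

Lemma whitenK K2 : involutive (whiten K2).
Proof. by move=> pi; apply/permP => x; rewrite !whitenE !bxorK. Qed.

Lemma whitenV K2 pi : ((whiten K2 pi)^-1)%g = whiten K2 pi^-1%g.
Proof.
apply/permP => x; apply: (@perm_inj _ (whiten K2 pi)).
by rewrite permKV !whitenE bxorK permKV bxorK.
Qed.

Definition update_cipher E K1 pi : Ics k n :=
  [ffun j => if j == K1 then pi else E j].

(** The patch is made on the FX permutation [whiten K.2 (E K.1)]; the outer [whiten], an involution,
    carries it back to the cipher. *)
Definition reprogram E (K : bits k * bits n) P : Ics k n :=
  update_cipher E K.1 (whiten K.2 (patch_queries fwd y P (whiten K.2 (E K.1)))).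

Lemma update_cipher_id E K1 : update_cipher E K1 (E K1) = E.
Proof. by apply/ffunP => j; rewrite ffunE; case: eqP => [->|]. Qed.

Lemma update_cipher_eq E K1 pi : update_cipher E K1 pi K1 = pi.
Proof. by rewrite ffunE eqxx. Qed.

Lemma update_cipherK E K1 pi rho :
  update_cipher (update_cipher E K1 pi) K1 rho = update_cipher E K1 rho.
Proof. by apply/ffunP => j; rewrite !ffunE; case: eqP. Qed.

Lemma sum_update_cipher (V : nmodType) K1 (F : Ics k n -> V) :
  \sum_E \sum_pi F (update_cipher E K1 pi) =
  \sum_E F E *+ #|{: {perm bits n}}|.
Proof.
(* Exchanging [pi] with the entry of [E] at [K1] is an involution on pairs. *)
pose h (Epi : Ics k n * {perm bits n}) := (update_cipher Epi.1 K1 Epi.2, Epi.1 K1).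
have hK : involutive h.
  by case=> E pi; rewrite /h /= update_cipherK update_cipher_id update_cipher_eq.
transitivity (\sum_E \sum_(pi : {perm bits n}) F E).
  by rewrite !pair_big /= [RHS](reindex_inj (inv_inj hK)).
by apply: eq_bigr => E _; rewrite sumr_const.
Qed.

Lemma sum_reprogram (R : numDomainType) K (F : Ics k n -> answers q n -> R) :
  \sum_E \sum_P F (reprogram E K P) (ans P) =
  \sum_E F E (ans (whiten K.2 (E K.1))) *+ #|{: {perm bits n}}|.
Proof.
have N0 : (0 < #|{: {perm bits n}}|)%N by rewrite (cardD1 1%g) inE.
(* The extra factor allows [E K.1] to be resampled on both sides; [sum_patch_queries] then applies
   for each [E]. *)
apply: (pmulrnI N0); rewrite -!sumrMnl.
rewrite -(sum_update_cipher K.1 (fun E => \sum_P F (reprogram E K P) (ans P))).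
rewrite -(sum_update_cipher K.1
  (fun E => F E (ans (whiten K.2 (E K.1))) *+ #|{: {perm bits n}}|)).
apply: eq_bigr => E _; rewrite exchange_big /=.
rewrite [RHS](reindex_inj (inv_inj (whitenK K.2))) /=.
have := sum_patch_queries fwd y
  (fun pi a => F (update_cipher E K.1 (whiten K.2 pi)) a).
under [X in _ -> _ = X]eq_bigr do rewrite update_cipher_eq.
under [in X in _ -> X = _]eq_bigr => P _.
  rewrite (reindex_inj (inv_inj (whitenK K.2))) /=.
  under eq_bigr do
    rewrite /reprogram update_cipher_eq update_cipherK whitenK.
  over.
move=> ->; by apply: eq_bigr => pi _; rewrite !whitenK.
Qed.

(* The oracle inputs (direction, cipher key, point) at which [reprogram E K P]
   may differ from [E]. *)
Definition touched E P (K : bits k * bits n) (t : bool * bits k * bits n) : bool :=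
  let: (c, j, x) := t in
  let s := query_points fwd y P in
  (j == K.1) &&
  (if c then (bxor x K.2 \in map P s) || (bxor ((E j)^-1%g x) K.2 \in s)
   else (bxor x K.2 \in s) || (bxor (E j x) K.2 \in map P s)).

Lemma reprogram_untouched E P K t :
  ~~ touched E P K t -> oracle_fun (reprogram E K P) t = oracle_fun E t.
Proof.
case: t => [[c j] x] /=; rewrite /Einv /Eval ffunE.
have [->|] /= := eqVneq j K.1; last by case: c.
set s := query_points fwd y P.
have off z : bxor z K.2 \notin s -> bxor (E K.1 z) K.2 \notin map P s ->
    whiten K.2 (patch_queries fwd y P (whiten K.2 (E K.1))) z = E K.1 z.
  move=> zs Ezs; rewrite whitenE /patch_queries patch_off //.
    by rewrite whitenE !bxorK.
  by rewrite whitenE bxorK.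
case: c; rewrite negb_or => /andP[h1 h2]; last exact: off.
(* The inverse direction is the forward one at the preimage of [x] under [E K.1]. *)
apply: (@perm_inj _ (whiten K.2 (patch_queries fwd y P (whiten K.2 (E K.1))))).
by rewrite permKV off ?permKV.
Qed.

Lemma card_touched E P t : (#|[pred K | touched E P K t]| <= 2 * q)%N.
Proof.
case: t => [[c j] x]; set s := query_points fwd y P.
pose z := if c then (E j)^-1%g x else E j x.
(* [K1] must be [j], and [K2] is the xor of the cipher input with a query point or of the cipher
   output with the image of one: [q] choices each. *)
pose l := [seq (j, K2) | K2 <-
  map (bxor (if c then z else x)) s ++ map (bxor (if c then x else z)) (map P s)].
have <- : size l = (2 * q)%N.
  by rewrite !size_map size_cat !size_map -enumT size_enum_ord mul2n addnn.
apply: leq_trans (card_size l); apply: subset_leq_card; apply/subsetP => -[K1 K2].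
have sw (S : seq (bits n)) u : bxor u K2 \in S -> K2 \in map (bxor u) S.
  by move=> h; apply/mapP; exists (bxor u K2); rewrite // bxorKl.
rewrite inE /= => /andP[/eqP <- h]; apply: map_f; rewrite mem_cat.
apply/orP; move: h; rewrite /z => {z l}; case: c => /orP[] /sw; by [left | right].
Qed.

End Reprogram.

(** * Averaging over ciphers, permutations and keys *)

Theorem theorem2 (R : realType) (k n p q : nat) (A : adversary R k n p q) :
  adv_sprp_na A <= Num.sqrt ((8 * p ^ 2 * q)%:R / (2 ^ (k + n))%:R : R).
Proof.
pose fwd := [pred i : 'I_q | (i < nev A)%N].
pose ans := query_answers fwd (qin A).
have realE E K : real_answers A E K.1 K.2 = ans (whiten K.2 (E K.1)).
  by apply/ffunP => i; rewrite !ffunE /= whitenV !whitenE.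
set N := (2 ^ (k + n))%N.
have NE : #|{: bits k * bits n}| = N.
  by rewrite card_prod !card_ffun !card_bool !card_ord -expnD.
have N0 : (0 < N%:R :> R) by rewrite ltr0n expn_gt0.
set cE := #|{: Ics k n}|; set cP := #|{: {perm bits n}}|.
have cE0 : (0 < cE%:R :> R).
  by rewrite ltr0n /cE; apply/card_gt0P; exists [ffun=> 1%g].
have cP0 : (0 < cP%:R :> R) by rewrite ltr0n; apply/card_gt0P; exists 1%g.
set bound := (X in _ <= X).
have key E P : \sum_(K : bits k * bits n)
    (prob_out1 A (reprogram fwd (qin A) E K P) (ans P) - prob_out1 A E (ans P))
    <= bound * N%:R.
  pose S := touched fwd (qin A) E P.
  apply: (@le_trans _ _ (\sum_(i < p) \sum_K
      Num.sqrt (\sum_(z | S K z.1.1) sqnorm (run_aux E (ans P) i z : R[i])) *+ 2)).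
    rewrite exchange_big; apply: ler_sum => K _ /=.
    by apply: prob_out1B_le => t; apply: reprogram_untouched.
  apply: (@le_trans _ _ (\sum_(i < p) (Num.sqrt (N * (2 * q))%:R *+ 2))).
    apply: ler_sum => i _; rewrite sumrMnl ler_pMn2r // -NE.
    by apply: sum_hit_le; [apply: card_touched | apply: sum_sqnorm_run].
  rewrite sumr_const card_ord -mulrnA.
  (* Both sides are nonnegative with square [8 p^2 q N]. *)
  suff -> : bound * N%:R = Num.sqrt (N * (2 * q))%:R *+ (2 * p) by [].
  rewrite -[LHS]ger0_norm ?mulr_ge0 ?sqrtr_ge0 ?ler0n // -sqrtr_sqr.
  rewrite -[RHS]ger0_norm ?mulrn_wge0 ?sqrtr_ge0 // -[RHS]sqrtr_sqr.
  congr Num.sqrt; rewrite exprMn sqr_sqrtr ?divr_ge0 ?ler0n //.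
  rewrite -[_ *+ (2 * p)]mulr_natr exprMn sqr_sqrtr ?ler0n // !natrM natrX.
  by field; rewrite expf_neq0 // pnatr_eq0.
rewrite /adv_sprp_na NE -/cE -/cP.
(* The factors [cP] here and [N] in [idealS] put both games on the common space of triples [E], [P],
   [K]. *)
have realS : (\sum_E \sum_K prob_out1 A E (real_answers A E K.1 K.2)) * cP%:R =
    \sum_E \sum_P \sum_K prob_out1 A (reprogram fwd (qin A) E K P) (ans P).
  transitivity (\sum_K \sum_E prob_out1 A E (ans (whiten K.2 (E K.1))) *+ cP).
    rewrite exchange_big /= mulr_natr -sumrMnl; apply: eq_bigr => K _.
    by rewrite -sumrMnl; apply: eq_bigr => E _; rewrite realE.
  under [RHS]eq_bigr do rewrite exchange_big.
  rewrite [RHS]exchange_big; apply: eq_bigr => K _ /=.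
  by rewrite (sum_reprogram _ _ K (prob_out1 A)).
have idealS : (\sum_E \sum_P prob_out1 A E (ideal_answers A P)) * N%:R =
    \sum_E \sum_P \sum_(K : bits k * bits n) prob_out1 A E (ans P).
  rewrite mulr_suml; apply: eq_bigr => E _; rewrite mulr_suml; apply: eq_bigr => P _.
  by rewrite sumr_const NE mulr_natr.
have total : \sum_E \sum_P \sum_K
    (prob_out1 A (reprogram fwd (qin A) E K P) (ans P) - prob_out1 A E (ans P))
    <= bound * N%:R * (cE * cP)%:R.
  apply: (@le_trans _ _ (\sum_(E : Ics k n) \sum_(P : {perm bits n}) bound * N%:R)).
    by apply: ler_sum => E _; apply: ler_sum => P _; apply: key.
  by rewrite !sumr_const -mulrnA [leRHS]mulr_natr mulnC.
move: total; under eq_bigr do under eq_bigr do rewrite sumrB.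
under eq_bigr do rewrite sumrB.
rewrite sumrB -realS -idealS => total.
rewrite !natrM.
set a := \sum_E _ in total *; set b := \sum_E _ in total *.
have -> : a / (cE%:R * N%:R) - b / (cE%:R * cP%:R) =
    (a * cP%:R - b * N%:R) / (N%:R * (cE%:R * cP%:R)).
  by field; rewrite !gt_eqF.
by rewrite ler_pdivrMr ?mulr_gt0 // -[cE%:R * _]natrM mulrA.
Qed.
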